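(* Let $d,N,k$ be positive integers with $N>d>k\ge 1$. Then the Cover--Efron cones $C_N$ and $C_{N+1}$ in $\mathbb{R}^d$ satisfy $$\frac{\mathbb{E} f_k(C_{N+1})}{\binom{N+1}{k}} < \frac{\mathbb{E} f_k(C_N)}{\binom{N}{k}}.$$
   Context: Let $\phi$ be a probability measure on $\mathbb{R}^d$ which is even (i.e. $\phi(A)=\phi(-A)$ for Borel sets $A$) and assigns measure zero to each hyperplane through the origin. For $N\ge d+1$ let $X_1,\dots,X_N$ be independent random vectors with distribution $\phi$, and let $\mathrm{pos}$ denote the positive hull (set of all nonnegative linear combinations). The Cover--Efron cone $C_N$ is the random cone whose distribution is that of $\mathrm{pos}\{X_1,\dots,X_N\}$ conditioned on the event that this positive hull is different from $\mathbb{R}^d$. For a polyhedral convex cone $C\subset\mathbb{R}^d$ and $k\in\{1,\dots,d-1\}$, $f_k(C)$ denotes the number of $k$-dimensional faces of $C$. $\mathbb{E}$ denotes expectation. The cones $C_N$ and $C_{N+1}$ are defined with the same $d$ and the same $\phi$. *)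

(* Defs.v *)
From HB Require Import structures.
From mathcomp Require Import all_boot all_order all_algebra.
From mathcomp Require Import all_classical all_reals all_analysis.
Import Order.TTheory GRing.Theory Num.Theory.
Import numFieldNormedType.Exports.

Set Implicit Arguments.
Unset Strict Implicit.
Unset Printing Implicit Defensive.

Local Open Scope classical_set_scope.
Local Open Scope ring_scope.

(* Matrices, in particular the row vectors representing R^d, carry the Borel
   sigma-algebra of their usual topology. *)
HB.instance Definition _ (R : realType) (m n : nat) :=
  Measurable.copy 'M[R]_(m, n) (g_sigma_algebraType (@open 'M[R]_(m, n))).

Section cones.
Context {R : realType} {d : nat}.
Implicit Types (u x : 'rV[R]_d) (C F : set 'rV[R]_d).

Definition inner u x : R := (u *m x^T) 0 0.

Definition pos (n : nat) (x : 'I_n -> 'rV[R]_d) : set 'rV[R]_d :=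
  [set y | exists c : 'I_n -> R,
     (forall i, 0 <= c i) /\ y = \sum_(i < n) c i *: x i].

(* F is the intersection of C with a supporting hyperplane. Supporting
   hyperplanes of a cone pass through the origin; the degenerate choice u = 0
   makes C a face of itself. *)
Definition face C F : Prop :=
  exists u, (forall x, C x -> inner u x <= 0) /\
            F = [set x | C x /\ inner u x = 0].

Definition linear_hull F (V : {vspace 'rV[R]_d}) : Prop :=
  F `<=` [set` V] /\
  forall W : {vspace 'rV[R]_d}, F `<=` [set` W] -> (V <= W)%VS.

(* Faces of a cone contain the origin, so their affine and linear hulls
   coincide. *)
Definition has_dim F (k : nat) : Prop :=
  exists V : {vspace 'rV[R]_d}, linear_hull F V /\ (\dim V)%VS = k.

Definition faces (k : nat) C : set (set 'rV[R]_d) :=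
  [set F | face C F /\ has_dim F k].

Definition num_faces (k : nat) C : \bar R := counting (faces k C).

End cones.

Section laws.
Context {R : realType} {d : nat}.

Definition even_measure (phi : probability 'rV[R]_d R) : Prop :=
  forall A, measurable A -> phi A = phi [set - x | x in A].

Definition null_on_hyperplanes (phi : probability 'rV[R]_d R) : Prop :=
  forall u : 'rV[R]_d, u != 0 -> phi [set x | inner u x = 0] = 0%E.

End laws.

Section sampling.
Context {R : realType} {disp : measure_display} {T : measurableType disp}.
Variable P : probability T R.

Definition mutually_independent disp' (U : measurableType disp') (n : nat)
    (X : 'I_n -> {mfun T >-> U}) : Prop :=
  forall (J : {set 'I_n}) (A : 'I_n -> set U),
    (forall i, i \in J -> measurable (A i)) ->
    P (\bigcap_(i in [set` J]) X i @^-1` A i) =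
    (\prod_(i in J) P (X i @^-1` A i))%E.

Definition iid disp' (U : measurableType disp') (phi : probability U R)
    (n : nat) (X : 'I_n -> {mfun T >-> U}) : Prop :=
  (forall i A, measurable A -> distribution P (X i) A = phi A) /\
  mutually_independent X.

Definition cond_probability (E : set T) : set T -> \bar R :=
  fun A => (P (A `&` E) / P E)%E.

Context {d : nat}.

(* The Cover-Efron cone is modelled as the random cone pos {X_1, ..., X_n} on T,
   where T carries the conditional probability given that the cone is proper;
   this is its mean number of k-faces. *)
Definition cover_efron_mean_faces (n : nat) (X : 'I_n -> {mfun T >-> 'rV[R]_d})
    (k : nat) : \bar R :=
  let C w := pos (fun i => X i w) in
  (\int[cond_probability [set w | C w <> setT]]_w num_faces k (C w))%E.

End sampling.

(* Main.v *)
Require Import Defs.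
From HB Require Import structures.
From mathcomp Require Import all_boot all_order all_algebra.
From mathcomp Require Import all_classical all_reals all_analysis.
From mathcomp Require Import measurable_realfun ring lra zify.
Import Order.TTheory GRing.Theory Num.Theory.
Import numFieldNormedType.Exports.

Set Implicit Arguments.
Unset Strict Implicit.
Unset Printing Implicit Defensive.

Local Open Scope classical_set_scope.
Local Open Scope ring_scope.

(* Whether I spans a face of the cone, and whether the cone is proper, depends
   only on the set of sign patterns (sgn <u, X_i>)_i with <u, X_i> = 0 on I and
   <u, X_i> <> 0 off I. For vectors in general position the number of realizable
   patterns satisfies the recursion of the chamber numbers C(n, m), here
   schlaefli n m: a pattern extends to one more vector in two ways exactly when it
   is already realized on the orthogonal hyperplane. Since phi is even, all sign
   changes of the sample have the same law, so each of the 2^N patterns has the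
   same probability and E f_k(C_N) / binom(N, k) = 2^k C(N-k, d-k) / C(N, d). The
   inequality follows from the strict log-concavity of m |-> C(n, m). *)

(** Spanning a face is an existential statement over a continuum of functionals, and degenerate
    samples escape the combinatorics. The face event therefore gets a measurable substitute that
    agrees with it in general position, and the face count is only compared with a measurable sum
    outside a null set. The conditioning event, in contrast, has to be measurable as it stands,
    degenerate samples included, for the conditional probability to be a measure. In general
    position, properness of the cone is the face condition for the empty index set. Every other face
    condition implies it, so conditioning only divides by C(N, d) / 2^N. Once the binomials cancel,
    expanding the terms at N + 1 by the recursion leaves a comparison of C(n, m+1) / C(n, m) at
    (N-k, d-k-1) and at (N, d-1); log-concavity makes this ratio decrease along the diagonal. *)

(** * Inner products and linear independence *)

Section inner_product.
Context {R : realType} {d : nat}.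
Implicit Types (u v x y : 'rV[R]_d).

Lemma innerE u x : inner u x = \sum_j u 0 j * x 0 j.
Proof. by rewrite /inner mxE; apply: eq_bigr => j _; rewrite mxE. Qed.

Lemma innerC u x : inner u x = inner x u.
Proof. by rewrite !innerE; apply: eq_bigr => j _; rewrite mulrC. Qed.

Lemma innerDl u v x : inner (u + v) x = inner u x + inner v x.
Proof. by rewrite /inner mulmxDl mxE. Qed.

Lemma innerZl a u x : inner (a *: u) x = a * inner u x.
Proof. by rewrite /inner -scalemxAl mxE. Qed.

Lemma innerNl u x : inner (- u) x = - inner u x.
Proof. by rewrite -scaleN1r innerZl mulN1r. Qed.

Lemma innerDr u x y : inner u (x + y) = inner u x + inner u y.
Proof. by rewrite innerC innerDl !(innerC u). Qed.

Lemma innerZr a u x : inner u (a *: x) = a * inner u x.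
Proof. by rewrite innerC innerZl innerC. Qed.

Lemma innerNr u x : inner u (- x) = - inner u x.
Proof. by rewrite innerC innerNl innerC. Qed.

Lemma inner0l x : inner 0 x = 0.
Proof. by rewrite -(scale0r 0) innerZl mul0r. Qed.

Lemma inner0r u : inner u 0 = 0.
Proof. by rewrite innerC inner0l. Qed.

Lemma inner_sumr (I : Type) (r : seq I) (P : pred I) u (F : I -> 'rV[R]_d) :
  inner u (\sum_(i <- r | P i) F i) = \sum_(i <- r | P i) inner u (F i).
Proof.
by apply: (big_morph (inner u)) => [x y|]; rewrite ?innerDr ?inner0r.
Qed.

Lemma inner_ge0 u : 0 <= inner u u.
Proof. by rewrite innerE; apply: sumr_ge0 => j _; rewrite -expr2 sqr_ge0. Qed.

Lemma inner_eq0 u : (inner u u == 0) = (u == 0).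
Proof.
apply/idP/idP => [|/eqP ->]; last by rewrite inner0l.
rewrite innerE psumr_eq0 => [/allP h|j _]; last by rewrite -expr2 sqr_ge0.
apply/eqP/rowP => j; rewrite mxE.
by have := h j (mem_index_enum _); rewrite /= mulf_eq0 orbb => /eqP.
Qed.

Lemma inner_gt0 u : (0 < inner u u) = (u != 0).
Proof. by rewrite lt_def inner_ge0 andbT inner_eq0. Qed.

Lemma inner_span_eq0 u (X : seq 'rV[R]_d) x :
  {in X, forall y, inner u y = 0} -> x \in <<X>>%VS -> inner u x = 0.
Proof.
move=> h xX; rewrite (coord_span (X := in_tuple X) xX) inner_sumr big1 // => i _.
by rewrite innerZr h ?mulr0 // mem_nth.
Qed.

(** The [d] independent vectors span the whole space, so [u] is orthogonal to itself. *)
Lemma free_full u (X : seq 'rV[R]_d) :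
  free X -> size X = d -> {in X, forall y, inner u y = 0} -> u = 0.
Proof.
move=> fX sX h; apply/eqP; rewrite -inner_eq0; apply/eqP.
apply: inner_span_eq0 h _; suff -> : <<X>>%VS = fullv by rewrite memvf.
apply/eqP; rewrite eqEdim subvf /= dimvf /dim /= mul1n.
by move: fX; rewrite /free => /eqP ->; rewrite sX.
Qed.

Lemma linear_inner (f : {scalar 'rV[R]_d}) : exists v, forall x, f x = inner v x.
Proof.
exists (\row_j f (delta_mx 0 j)) => x.
rewrite [in LHS](row_sum_delta x) linear_sum innerE; apply: eq_bigr => j _.
by rewrite linearZ mxE mulrC.
Qed.

(** [v] represents the coordinate functional of [a] in the free family; it is the direction in which
    functionals are moved off the hyperplane orthogonal to [a]. *)
Lemma free_cons_dual a (Z : seq 'rV[R]_d) : free (a :: Z) ->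
  exists v, inner v a = 1 /\ {in Z, forall z, inner v z = 0}.
Proof.
move=> fr; have [v hv] := linear_inner (coord (in_tuple (a :: Z)) ord0).
exists v; split; first by rewrite -hv; exact: (@coord_free _ _ _ (in_tuple (a :: Z)) ord0 ord0 fr).
move=> z /(nthP 0)[i iZ <-]; rewrite -hv.
have iX : (i.+1 < size (a :: Z))%N by [].
exact: (@coord_free _ _ _ (in_tuple (a :: Z)) (Ordinal iX) ord0 fr).
Qed.

End inner_product.

(** * Realizable sign patterns and their extension by one vector *)

Section sign_patterns.
Context {R : realType} {d : nat} {I : eqType}.
Variable x : I -> 'rV[R]_d.
Implicit Types (u v : 'rV[R]_d) (l : seq (I * option bool)) (Z : seq I).

Definition satisfies u (a : 'rV[R]_d) (c : option bool) : bool :=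
  match c with
  | None => inner u a == 0
  | Some true => 0 < inner u a
  | Some false => inner u a < 0
  end.

Definition realizable l : Prop :=
  exists u, forall p, p \in l -> satisfies u (x p.1) p.2.

Definition zeros l := [seq p.1 | p <- l & p.2 == None].

Lemma mem_zeros l z : z \in zeros l -> (z, None) \in l.
Proof.
by case/mapP => -[i c] /=; rewrite mem_filter => /andP[/eqP /= ->] + ->.
Qed.

Lemma realizable_sub l l' : {subset l' <= l} -> realizable l -> realizable l'.
Proof. by move=> s [u h]; exists u => p /s/h. Qed.

(** The strict inequalities are finitely many open conditions, and the equations survive because [v]
    vanishes on the zeros. *)
Lemma perturb u v l :
    (forall p, p \in l -> satisfies u (x p.1) p.2) ->
    {in zeros l, forall z, inner v (x z) = 0} ->
  exists2 t, 0 < t & forall s, `|s| <= t ->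
    forall p, p \in l -> satisfies (u + s *: v) (x p.1) p.2.
Proof.
elim: l => [|[i c] l ih] hu hv; first by exists 1.
have [| |t t0 ht] := ih.
- by move=> p pl; apply: hu; rewrite inE pl orbT.
- move=> z zl; apply: hv; rewrite /zeros /=.
  by case: ifP => _ //=; rewrite inE zl orbT.
have := hu _ (mem_head _ _) => /= hi.
set a := inner u (x i); set b := inner v (x i).
(* The perturbation of the value [a] stays below half of it and cannot change its sign; the [+ 1]
   covers the case [b = 0]. *)
have bnd (s : R) : a != 0 -> `|s| <= `|a| / (2 * (`|b| + 1)) ->
    - (`|a| / 2) <= s * b <= `|a| / 2.
  move=> a0 hs; rewrite -ler_norml normrM.
  have b1 : 0 < `|b| + 1 by rewrite ltr_wpDl.
  apply: (@le_trans _ _ (`|a| / (2 * (`|b| + 1)) * (`|b| + 1))).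
    by apply: ler_pM => //; rewrite lerDl.
  by rewrite invfM !mulrA divfK ?gt_eqF.
have b1 : 0 < `|b| + 1 by rewrite ltr_wpDl.
case: c hi hu hv => [c|] hi hu hv.
  have a0 : a != 0 by case: c hi {hu hv} => /=; [move/gt_eqF|move/lt_eqF] => ->.
  have an0 : 0 < `|a| by rewrite normr_gt0.
  exists (Num.min t (`|a| / (2 * (`|b| + 1)))).
    by rewrite lt_min t0 divr_gt0 ?mulr_gt0.
  move=> s; rewrite le_min => /andP[st sa] p; rewrite inE => /orP[/eqP ->|]; last exact: ht.
  have /andP[h1 h2] := bnd s a0 sa.
  rewrite /satisfies /= innerDl innerZl -/a -/b; case: c hi {hu hv} => /= hi.
    by rewrite gtr0_norm // in h1; rewrite -/a in hi; lra.
  by rewrite ltr0_norm // in h2; rewrite -/a in hi; lra.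
exists t => // s st p; rewrite inE => /orP[/eqP ->|]; last exact: ht.
rewrite /satisfies /= innerDl innerZl (eqP hi) hv ?mulr0 ?addr0 //.
by rewrite /zeros /= inE eqxx.
Qed.

(** A functional vanishing at [x y] is pushed to either side along the dual vector of [x y], which
    leaves the other zeros untouched. *)
Lemma realizable_split y l : free [seq x i | i <- y :: zeros l] ->
  realizable ((y, None) :: l) ->
  forall b, realizable ((y, Some b) :: l).
Proof.
move=> /= /free_cons_dual[v [vy vZ]] [u hu] b.
have uy : inner u (x y) = 0 by have /eqP := hu _ (mem_head _ _).
have [||t t0 ht] := @perturb u v l.
- by move=> p pl; apply: hu; rewrite inE pl orbT.
- by move=> z zl; apply: vZ; apply: map_f.
have tt : `|t| <= t by rewrite gtr0_norm.
have ntt : `| - t| <= t by rewrite normrN.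
exists (u + (if b then t else - t) *: v) => p.
rewrite inE => /orP[/eqP ->|pl]; last by case: (b); apply: ht.
rewrite /satisfies /= innerDl innerZl uy vy mulr1 add0r.
by case: (b); rewrite ?oppr_lt0.
Qed.

(* The converse holds by convexity of the set of admissible functionals. *)
Lemma realizable_join y l :
  realizable ((y, Some true) :: l) -> realizable ((y, Some false) :: l) ->
  realizable ((y, None) :: l).
Proof.
move=> [u hu] [v hv].
have /= uy := hu _ (mem_head _ _); have /= vy := hv _ (mem_head _ _).
have a0 : 0 < - inner v (x y) by rewrite oppr_gt0.
exists ((- inner v (x y)) *: u + inner u (x y) *: v) => p.
rewrite inE => /orP[/eqP ->|pl].
  by rewrite /satisfies /= innerDl !innerZl mulNr mulrC addNr.
have up : satisfies u (x p.1) p.2 by apply: hu; rewrite inE pl orbT.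
have : satisfies v (x p.1) p.2 by apply: hv; rewrite inE pl orbT.
move: up.
case: p pl => i [[]|] _ /=; rewrite innerDl !innerZl.
- by move=> h1 h2; rewrite addr_gt0 // mulr_gt0.
- by move=> h1 h2; rewrite -oppr_gt0 opprD addr_gt0 // oppr_gt0 pmulr_rlt0.
- by move=> /eqP -> /eqP ->; rewrite !mulr0 addr0.
Qed.

Lemma realizable_cover y l : free [seq x i | i <- y :: zeros l] ->
  realizable l ->
  realizable ((y, Some true) :: l) \/ realizable ((y, Some false) :: l).
Proof.
move=> fr [u hu].
have ext c : satisfies u (x y) c -> realizable ((y, c) :: l).
  by move=> h; exists u => p; rewrite inE => /orP[/eqP ->|/hu].
have [h|h|h] := ltgtP (inner u (x y)) 0.
- by right; apply: ext.
- by left; apply: ext.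
- left; apply: realizable_split => //; apply: ext.
  exact/eqP.
Qed.

(* A pattern extends to one more vector in two ways exactly when it is also
   realized on the hyperplane orthogonal to that vector. *)
Lemma realizable_count_cons y l : free [seq x i | i <- y :: zeros l] ->
  (`[<realizable ((y, Some true) :: l)>] + `[<realizable ((y, Some false) :: l)>]
   = `[<realizable l>] + `[<realizable ((y, None) :: l)>])%N.
Proof.
move=> fr.
have drop c : realizable ((y, c) :: l) -> realizable l.
  by apply: realizable_sub => p; rewrite inE orbC => ->.
have [h1|h1] := asboolP (realizable ((y, Some true) :: l));
  have [h2|h2] := asboolP (realizable ((y, Some false) :: l)).
- have h0 := realizable_join h1 h2.
  by rewrite (asboolT (drop _ h1)) (asboolT h0).
- rewrite (asboolT (drop _ h1)) asboolF // => h0.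
  exact: h2 (realizable_split fr h0 _).
- rewrite (asboolT (drop _ h2)) asboolF // => h0.
  exact: h1 (realizable_split fr h0 _).
- rewrite !asboolF //.
    by move=> h0; exact: h1 (realizable_split fr h0 _).
  by move=> /(realizable_cover fr)[].
Qed.

End sign_patterns.

(** * Counting realizable sign patterns *)

Section counting_patterns.
Local Open Scope nat_scope.

(* The Cover-Efron (Schlaefli) numbers: a hyperplane arrangement in general
   position with n hyperplanes in dimension m has schlaefli n m chambers. *)
Fixpoint schlaefli (n m : nat) : nat :=
  match n, m with
  | 0, _ => 1
  | _.+1, 0 => 0
  | n'.+1, m'.+1 => schlaefli n' m'.+1 + schlaefli n' m'
  end.

Fixpoint bitseqs (n : nat) : seq bitseq :=
  if n is n'.+1 then map (cons true) (bitseqs n') ++ map (cons false) (bitseqs n')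
  else [:: [::]].

Lemma size_bitseqs n : size (bitseqs n) = 2 ^ n.
Proof. by elim: n => //= n ih; rewrite size_cat !size_map ih addnn expnS mul2n. Qed.

Lemma bitseqs_size n s : s \in bitseqs n -> size s = n.
Proof.
elim: n s => [|n ih] s /=; first by rewrite inE => /eqP ->.
by rewrite mem_cat => /orP[] /mapP[t /ih <- ->].
Qed.

Context {R : realType} {d : nat} {I : eqType}.
Variable x : I -> 'rV[R]_d.

Definition general_position :=
  forall s : seq I, uniq s -> size s <= d -> free [seq x i | i <- s].

(** A flag [true] in [xs] forces a zero and makes the matching entry of [s] idle. Keeping these idle
    signs lets [s] range over all sign changes of the sample; they account for the power of 2 in the
    count. *)
Definition pattern (Z : seq I) (xs : seq (I * bool)) (s : bitseq)
    : seq (I * option bool) :=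
  [seq (z, None) | z <- Z] ++
  [seq (p.1.1, if p.1.2 then None else Some p.2) | p <- zip xs s].

Lemma zeros_pattern Z xs s : size s = size xs ->
  zeros (pattern Z xs s) = Z ++ [seq p.1 | p <- xs & p.2].
Proof.
rewrite /zeros /pattern filter_cat map_cat => ss; congr cat.
  by elim: Z => //= z Z ->.
elim: xs s ss => [|[i b] xs ih] [|c s] //= [/ih].
by case: b => /= ->.
Qed.

(** [Z] varies in the induction because an unflagged vector contributes, by [realizable_count_cons],
    the pattern without it and the pattern where it has become a zero: the two terms of the
    recursion of [schlaefli]. *)
Lemma count_realizable Z xs :
    general_position -> uniq (Z ++ map fst xs) ->
    size Z + count snd xs <= d ->
  \sum_(s <- bitseqs (size xs)) `[<realizable x (pattern Z xs s)>] =
  2 ^ count snd xs *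
    schlaefli (size xs - count snd xs) (d - (size Z + count snd xs)).
Proof.
move=> gp; elim: xs Z => [|[y b] xs ih] Z /= un sz.
  rewrite big_seq1 mul1n asboolT //; exists 0%R => p.
  by rewrite /pattern cats0 => /mapP[z _ ->] /=; rewrite inner0l.
have unZ : uniq ((y :: Z) ++ map fst xs).
  by rewrite -cat1s -catA uniq_catCA.
have unZ' : uniq (Z ++ map fst xs) by move: unZ => /= /andP[].
rewrite big_cat /= !big_map /=.
have shift s c : (realizable x ((y, c) :: pattern Z xs s)) =
    realizable x ([seq (z, None) | z <- Z] ++ (y, c) ::
      [seq (p.1.1, if p.1.2 then None else Some p.2) | p <- zip xs s]).
  apply/propext; rewrite /pattern; split; apply: realizable_sub => p;
  by rewrite !(inE, mem_cat) orbCA.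
case: b sz => /= sz.
  have e : size (y :: Z) + count snd xs = size Z + (true + count snd xs).
    by rewrite /= addSnnS.
  have := ih (y :: Z) unZ; rewrite e => /(_ sz) => ih1.
  rewrite subSS expnS -mulnA mul2n -addnn -ih1.
  by congr (_ + _); apply: eq_bigr => s _; rewrite /pattern /= -shift.
rewrite add0n in sz *.
under eq_bigr do rewrite /pattern /= -shift.
under [X in _ + X = _]eq_bigr do rewrite /pattern /= -shift.
rewrite -big_split /= subSn ?count_size //.
(* With [d] zeros already imposed only the zero functional is left, and it has no strict sign at
   [y]; this is the value 0 of [schlaefli] at dimension 0. *)
have [sz'|] := ltnP (size Z + count snd xs) d; last first.
  move=> sz2; have {sz2}sz' : size Z + count snd xs = d.
    by apply/eqP; rewrite eqn_leq sz.
  rewrite sz' subnn muln0 big_seq big1 // => s /bitseqs_size ss.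
  have nope b : ~ realizable x ((y, Some b) :: pattern Z xs s).
    move=> [u hu]; have := hu _ (mem_head _ _).
    suff -> : u = 0%R by case: b {hu} => /=; rewrite inner0l ltxx.
    apply: (@free_full _ _ _ [seq x i | i <- zeros (pattern Z xs s)]).
    - apply: gp; rewrite zeros_pattern // ?size_cat ?size_map ?size_filter ?sz' //.
      apply: subseq_uniq unZ'; rewrite cat_subseq //.
      by rewrite map_subseq // filter_subseq.
    - by rewrite size_map zeros_pattern // size_cat size_map size_filter sz'.
    - move=> a /mapP[z /mem_zeros zp ->].
      by have /eqP := hu (z, None) ltac:(by rewrite inE zp orbT).
  by rewrite !asboolF.
have e : d - (size Z + count snd xs) = (d - (size (y :: Z) + count snd xs)).+1.
  by rewrite /= addSn subnSK.
rewrite e /= mulnDr -e -(ih Z unZ' sz) -(ih (y :: Z) unZ sz') -big_split /=.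
rewrite big_seq [in RHS]big_seq; apply: eq_bigr => s /bitseqs_size ss.
apply: realizable_count_cons; apply: gp.
  rewrite zeros_pattern //; apply: subseq_uniq unZ.
  rewrite cat_cons /= eqxx cat_subseq //.
  by rewrite map_subseq // filter_subseq.
by rewrite zeros_pattern //= size_cat size_map size_filter.
Qed.

End counting_patterns.

(** * Log-concavity of the Schlaefli numbers *)

Section schlaefli_numbers.
Local Open Scope nat_scope.

Lemma schlaefli_gt0 n m : 0 < schlaefli n m.+1.
Proof. by elim: n m => [|n ih] m //=; rewrite ltn_addr. Qed.

Lemma schlaefli_diag n m : n <= m -> schlaefli n m = 2 ^ n.
Proof.
elim: n m => [|n ih] [|m] //= nm.
by rewrite !ih // ?expnS ?mul2n ?addnn // ltnW.
Qed.

(** Adding neighbours, as the recursion does, preserves log-concavity. Equality holds where the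
    numbers are still the constant [2 ^ n], that is, where all sign patterns occur. *)
Lemma schlaefli_log_concave n m :
  schlaefli n m * schlaefli n m.+2 <= schlaefli n m.+1 * schlaefli n m.+1
  ?= iff (n <= m).
Proof.
have [nm|mn] := leqP n m.
  by rewrite !schlaefli_diag; [split; rewrite ?eqxx|lia|lia|lia].
suff lt : schlaefli n m * schlaefli n m.+2 < schlaefli n m.+1 * schlaefli n m.+1.
  by split; [exact: ltnW|rewrite ltn_eqF].
elim: n m mn => // n ih [|m] mn /=.
  rewrite mul0n muln_gt0 addn_gt0 schlaefli_gt0 orTb //.
set z := schlaefli n m; set a := schlaefli n m.+1.
set b := schlaefli n m.+2; set c := schlaefli n m.+3.
have a0 : 0 < a := schlaefli_gt0 n m.
have b0 : 0 < b := schlaefli_gt0 n m.+1.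
have h1 : z * b < a * a by apply: ih.
have h2 : a * c <= b * b.
  have [nm|nm] := leqP n m.+1; last exact/ltnW/ih.
  by rewrite /a /b /c !schlaefli_diag //; lia.
(* The mixed term of the expanded product: multiply [h1] and [h2] and cancel [a * b]. *)
have h3 : z * c <= a * b.
  rewrite -(leq_pmul2r (_ : 0 < a * b)) ?muln_gt0 ?a0 //.
  have -> : z * c * (a * b) = z * b * (a * c) by ring.
  have -> : a * b * (a * b) = a * a * (b * b) by ring.
  by rewrite leq_mul // ltnW.
rewrite !mulnDl !mulnDr [b * a]mulnC; lia.
Qed.

(** The quotient of neighbouring numbers decreases with each diagonal step: expanding the later row
    by the recursion cancels a common product and leaves log-concavity. Cross products are used
    because [schlaefli n 0] vanishes for positive [n]. *)
Lemma schlaefli_ratio n m j : m < n ->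
  schlaefli n m * schlaefli (n + j.+1) (m + j.+1).+1 <
  schlaefli n m.+1 * schlaefli (n + j.+1) (m + j.+1).
Proof.
have step n' m' : m' < n' ->
    schlaefli n' m' * schlaefli n'.+1 m'.+2 < schlaefli n' m'.+1 * schlaefli n'.+1 m'.+1.
  move=> h /=.
  have [h1 h2] := schlaefli_log_concave n' m'.
  have : schlaefli n' m' * schlaefli n' m'.+2 < schlaefli n' m'.+1 * schlaefli n' m'.+1.
    by rewrite ltn_neqAle h1 h2 -ltnNge h.
  by rewrite !mulnDr; lia.
elim: j => [|j ih] mn; first by rewrite !addn1; exact: step.
have := step (n + j.+1) (m + j.+1); rewrite ltn_add2r => /(_ mn) h2.
have {ih} h1 := ih mn.
rewrite ![_ + j.+2]addnS.
move: h1 h2; set a := schlaefli n m; set b := schlaefli n m.+1.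
set c := schlaefli (n + j.+1) (m + j.+1).
set e := schlaefli (n + j.+1) (m + j.+1).+1.
set f := schlaefli _ _; set g := schlaefli _ _ => h1 h2.
have := ltn_mul h1 h2.
have -> : a * e * (c * f) = (a * f) * (c * e) by ring.
have -> : b * c * (e * g) = (b * g) * (c * e) by ring.
by rewrite ltn_mul2r => /andP[].
Qed.

(** Expanding both numbers with [N.+1] by the recursion produces the same product on either side;
    what remains is [schlaefli_ratio] over [k] diagonal steps. *)
Lemma schlaefli_lt N d k : 0 < k -> k < d -> d < N ->
  schlaefli (N.+1 - k) (d - k) * schlaefli N d <
  schlaefli (N - k) (d - k) * schlaefli N.+1 d.
Proof.
case: k => // k _ kd dN.
have [m dE] : exists m, d = (m + k.+1).+1 by exists (d - k.+2); lia.
have [n NE] : exists n, N = n + k.+1 by exists (N - k.+1); lia.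
have mn : m < n by lia.
have -> : N.+1 - k.+1 = n.+1 by lia.
have -> : N - k.+1 = n by lia.
have -> : d - k.+1 = m.+1 by lia.
have := schlaefli_ratio k mn; rewrite -NE -dE => h.
rewrite {2}dE /= -dE mulnDl mulnDr ltn_add2l.
exact: h.
Qed.

End schlaefli_numbers.

(** * Farkas' lemma *)

Section farkas.
Context {R : realType} {d : nat}.
Implicit Types (u v y : 'rV[R]_d).

Lemma pos_inner_le0 n (x : 'I_n -> 'rV[R]_d) u y :
  (forall i, inner u (x i) <= 0) -> pos x y -> inner u y <= 0.
Proof.
move=> ux [c [c0 ->]]; rewrite inner_sumr; apply: sumr_le0 => i _.
by rewrite innerZr mulr_ge0_le0.
Qed.

Lemma pos_gen n (x : 'I_n -> 'rV[R]_d) i : pos x (x i).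
Proof.
exists (fun j => (j == i)%:R); split=> [j|]; first by rewrite ler0n.
rewrite (bigD1 i) //= eqxx scale1r big1 ?addr0 // => j /negbTE ->.
by rewrite scale0r.
Qed.

Lemma pos_cons n (x : 'I_n.+1 -> 'rV[R]_d) a (c : 'I_n -> R) :
  0 <= a -> (forall i, 0 <= c i) ->
  pos x (a *: x ord0 + \sum_i c i *: x (lift ord0 i)).
Proof.
move=> a0 c0; exists (fun i => if unlift ord0 i is Some j then c j else a).
split; first by move=> i; case: unlift.
rewrite big_ord_recl unlift_none; congr (_ + _).
by apply: eq_bigr => i _; rewrite liftK.
Qed.

(* Farkas' lemma. In the inductive step a functional u separating y from the
   other generators but not from z = x 0 serves to project everything to the
   hyperplane orthogonal to u along z. *)
Lemma farkas n (x : 'I_n -> 'rV[R]_d) y :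
  pos x y \/ exists u, (forall i, inner u (x i) <= 0) /\ 0 < inner u y.
Proof.
elim: n x y => [|n ih] x y.
  have [->|y0] := eqVneq y 0.
    by left; exists (fun=> 0); split=> //; rewrite big_ord0.
  by right; exists y; split; [case|rewrite inner_gt0].
set z := x ord0; have [[c [c0 ->]]|[u [ux uy]]] := ih (fun i => x (lift ord0 i)) y.
  by left; have := pos_cons x (lexx 0) c0; rewrite scale0r add0r.
have [uz|uz] := leP (inner u z) 0.
  by right; exists u; split=> // i; case: (unliftP ord0 i) => [j|] ->.
have uz0 : inner u z != 0 by rewrite gt_eqF.
pose pr (v : 'rV[R]_d) := v - (inner u v / inner u z) *: z.
have [[c [c0 yE]]|[v [vx vy]]] := ih (fun i => pr (x (lift ord0 i))) (pr y).
  left; have -> : y = (inner u y / inner u z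
      - \sum_i c i * (inner u (x (lift ord0 i)) / inner u z)) *: z
      + \sum_i c i *: x (lift ord0 i).
    rewrite -[LHS](subrK ((inner u y / inner u z) *: z)) -/(pr y) yE.
    under eq_bigr do rewrite /pr scalerBr scalerA.
    by rewrite sumrB scalerBl scaler_suml addrC -!addrA [X in _ + X]addrC.
  (* The coefficient of [z] is nonnegative because [u] is positive at [y] and [z] and nonpositive at
     the other generators. *)
  apply: pos_cons => //; rewrite addr_ge0 //; first by rewrite divr_ge0 // ltW.
  rewrite oppr_ge0; apply: sumr_le0 => i _.
  by rewrite mulr_ge0_le0 // mulr_le0_ge0 // invr_ge0 ltW.
right; exists (v - (inner v z / inner u z) *: u).
have prE w : inner (v - (inner v z / inner u z) *: u) w = inner v (pr w).
  rewrite innerDl innerNl innerZl /pr innerDr innerNr innerZr.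
  by congr (_ - _); rewrite mulrC -!mulrA; congr (_ * _); exact: mulrC.
split; last by rewrite prE.
move=> i; rewrite prE; case: (unliftP ord0 i) => [j|] -> //.
by rewrite /pr -/z divff // scale1r subrr inner0r.
Qed.

End farkas.

(** * Faces of positive hulls as index sets *)

Section faces_of_positive_hulls.
Context {R : realType} {d n : nat}.
Variable x : 'I_n -> 'rV[R]_d.
Implicit Types (u y : 'rV[R]_d) (I J : {set 'I_n}).

Definition signs I J : seq ('I_n * option bool) :=
  [seq (i, if i \in I then None else Some (i \in J)) | i <- enum 'I_n].

(** With the second set empty, all signs off [I] are negative, which matches the orientation of the
    functionals in [face]. *)
Definition facial I : Prop := realizable x (signs I finset.set0).

Lemma facialP I : facial I <-> exists u,
  forall i, if i \in I then inner u (x i) = 0 else inner u (x i) < 0.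
Proof.
split=> -[u hu]; exists u.
  move=> i; have := hu (i, if i \in I then None else Some (i \in finset.set0)).
  rewrite map_f ?mem_enum // => /(_ isT); rewrite inE /=.
  by case: ifP => // _ /eqP.
move=> p /mapP[i _ ->] /=; have := hu i; rewrite inE.
by case: ifP => _ //= ->.
Qed.

(** Splitting and joining at [i] trade the equation there for both strict signs; general position
    supplies the independence needed for the splitting. *)
Lemma realizable_signs1 I J i : general_position x -> (#|I| <= d)%N -> i \in I ->
  realizable x (signs I J) <->
  realizable x (signs (I :\ i)%SET (J :\ i)%SET) /\
  realizable x (signs (I :\ i)%SET (i |: J)%SET).
Proof.
move=> gp Id iI.
pose l := [seq (j, if j \in I then None else Some (j \in J)) | j <- enum 'I_n & j != i].
have sE c I' J' : (if i \in I' then None else Some (i \in J')) = c ->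
    (forall j, j != i -> (j \in I' = (j \in I)) * (j \in J' = (j \in J))) ->
    realizable x (signs I' J') <-> realizable x ((i, c) :: l).
  move=> ci cj; split; apply: realizable_sub => p.
    rewrite inE => /orP[/eqP ->|/mapP[j]]; first by rewrite -ci map_f ?mem_enum.
    rewrite mem_filter => /andP[ji _] ->; apply/mapP; exists j; rewrite ?mem_enum //.
    by rewrite !cj.
  move=> /mapP[j _ ->]; have [->|ji] := eqVneq j i; first by rewrite ci mem_head.
  rewrite !cj // inE; apply/orP; right; apply/mapP.
  by exists j => //; rewrite mem_filter ji mem_enum.
have zE : perm_eq (i :: zeros l) (enum I).
  apply: uniq_perm; rewrite ?enum_uniq //=.
    have lu : uniq (map fst l).
      by rewrite -map_comp map_id filter_uniq ?enum_uniq.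
    rewrite (subseq_uniq _ lu) ?map_subseq ?filter_subseq // andbT.
    apply/negP => /mem_zeros /mapP[j]; rewrite mem_filter => /andP[ji _] [ij _].
    by rewrite ij eqxx in ji.
  move=> j; rewrite inE mem_enum; have [->|ji] := eqVneq j i; first by rewrite iI.
  apply/idP/idP => /= [/mem_zeros /mapP[k _ [->]]|jI]; first by case: ifP.
  apply/mapP; exists (j, None) => //; rewrite mem_filter /=.
  by apply/mapP; exists j; rewrite ?jI // mem_filter ji mem_enum.
have fr : free [seq x j | j <- i :: zeros l].
  rewrite (perm_free (perm_map x zE)); apply: gp; rewrite ?enum_uniq //.
  by rewrite -cardE.
rewrite (sE None I J) ?iI // (sE (Some false)) ?(sE (Some true)); last first.
- by move=> j ji; rewrite !inE ji.
- by rewrite !inE eqxx.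
- by move=> j ji; rewrite !inE (negbTE ji).
- by rewrite !inE eqxx.
split=> [h|[h1 h2]]; last exact: realizable_join.
by split; apply: realizable_split.
Qed.

(* Trades the equations on I for finitely many open conditions, each of which is
   a countable union of boxes, so that the face event becomes measurable. *)
Lemma realizable_signs I J : general_position x -> (#|I| <= d)%N ->
  [disjoint I & J]%B ->
  realizable x (signs I J) <->
  forall K : {set 'I_n}, K \subset I -> realizable x (signs finset.set0 (J :|: K)%SET).
Proof.
move=> gp; elim: {I}#|I| {-2}I (erefl #|I|) J => [|m ih] I Im J Id dis.
  move/eqP: Im; rewrite cards_eq0 => /eqP ->; split=> [h K|/(_ finset.set0)].
    by rewrite finset.subset0 => /eqP ->; rewrite finset.setU0.
  by rewrite finset.sub0set finset.setU0; apply.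
have /card_gt0P[i iI] : (0 < #|I|)%N by rewrite Im.
have Im' : #|(I :\ i)%SET| = m by move: Im; rewrite (cardsD1 i) iI => -[].
have Id' : (#|(I :\ i)%SET| <= d)%N by rewrite Im' -ltnS -Im ltnW.
have iJ : i \notin J by rewrite (disjointFr dis).
have JE : (J :\ i)%SET = J by apply/finset.setDidPl; rewrite disjoint_sym disjoints1.
rewrite (realizable_signs1 J gp Id iI) JE !ih //; last first.
- by apply: disjointWl dis; rewrite finset.subsetDl.
- rewrite disjoint_sym finset.disjoints_subset finset.subUset finset.sub1set !inE eqxx /=.
  by rewrite -finset.disjoints_subset disjoint_sym; apply: disjointWl dis; rewrite finset.subsetDl.
split=> [[h1 h2] K KI|h].
  have [iK|iK] := boolP (i \in K).
    have -> : (J :|: K = i |: J :|: (K :\ i))%SET.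
      by rewrite -finset.setUA finset.setUCA finset.setD1K.
    by apply: h2; rewrite finset.setSD.
  by apply: h1; rewrite finset.subsetD1 KI.
split=> K; rewrite finset.subsetD1 => /andP[KI iK]; first exact: h.
rewrite -finset.setUA finset.setUCA; apply: h.
by rewrite finset.subUset finset.sub1set iI.
Qed.

Definition subpos I : set 'rV[R]_d :=
  [set y | exists c : 'I_n -> R, (forall i, 0 <= c i) /\
     y = \sum_(i in I) c i *: x i].

Lemma subpos_gen I i : i \in I -> subpos I (x i).
Proof.
move=> iI; exists (fun j => (j == i)%:R); split=> [j|]; first by rewrite ler0n.
rewrite (bigD1 i) //= eqxx scale1r big1 ?addr0 // => j /andP[_ /negbTE ->].
by rewrite scale0r.
Qed.

(** A vanishing sum of nonpositive terms has only zero terms, which kills the coefficients off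
    [I]. *)
Lemma subpos_face I u :
  (forall i, if i \in I then inner u (x i) = 0 else inner u (x i) < 0) ->
  [set y | pos x y /\ inner u y = 0] = subpos I.
Proof.
move=> hu; apply/seteqP; split=> [y [[c [c0 ->]]]|y [c [c0 ->]]] /=.
  rewrite inner_sumr => /eqP; rewrite eq_sym -subr_eq0 sub0r -sumrN psumr_eq0; last first.
    move=> i _; rewrite innerZr oppr_ge0 mulr_ge0_le0 //.
    by have := hu i; case: ifP => _ => [->|/ltW].
  move=> /allP h; exists c; split => //.
  rewrite [LHS](bigID [in I]) /= [X in _ + X]big1 ?addr0 // => i iI.
  have := h i (mem_index_enum _); rewrite /= innerZr oppr_eq0 mulf_eq0.
  have := hu i; rewrite (negbTE iI) => /lt_eqF ->; rewrite orbF => /eqP ->.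
  by rewrite scale0r.
split.
  exists (fun i => if i \in I then c i else 0); split.
    by move=> i; case: ifP.
  rewrite [RHS](bigID [in I]) /= [X in _ = _ + X]big1 ?addr0.
    by apply: eq_bigr => i ->.
  by move=> i /negbTE ->; rewrite scale0r.
rewrite inner_sumr big1 // => i iI; rewrite innerZr.
by have := hu i; rewrite iI => ->; rewrite mulr0.
Qed.

Lemma linear_hull_subpos I : linear_hull (subpos I) <<[seq x i | i <- enum I]>>%VS.
Proof.
split=> [y [c [_ ->]] /=|W hW].
  apply: rpred_sum => i iI; apply/rpredZ/memv_span/map_f.
  by rewrite mem_enum.
apply/span_subvP => y /mapP[i]; rewrite mem_enum => iI ->.
exact/hW/subpos_gen.
Qed.

Lemma dim_span_gp I : general_position x ->
  \dim <<[seq x i | i <- enum I]>>%VS = minn #|I| d.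
Proof.
move=> gp; have [Id|Id] := leqP #|I| d.
  have : free [seq x i | i <- enum I] by apply: gp; rewrite ?enum_uniq -?cardE.
  by rewrite /free => /eqP ->; rewrite size_map -cardE.
apply/eqP; rewrite eqn_leq; apply/andP; split.
  by have := dimvS (subvf <<[seq x i | i <- enum I]>>%VS); rewrite dimvf /dim /= mul1n.
have : free [seq x i | i <- take d (enum I)].
  by apply: gp; rewrite ?take_uniq ?enum_uniq // size_take; case: ifP; lia.
rewrite /free => /eqP; rewrite size_map size_takel => [e|]; last by rewrite -cardE ltnW.
rewrite -[X in (X <= _)%N]e.
by apply/dimvS/sub_span => y; rewrite map_take; apply: mem_take.
Qed.

(** The index set of a face collects the generators on its supporting hyperplane. *)
Lemma faces_pos k : general_position x -> (k < d)%N ->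
  (d <= n)%N ->
  faces k (pos x) =
  subpos @` [set I : {set 'I_n} | #|I| = k /\ facial I].
Proof.
move=> gp kd dn; apply/seteqP; split=> F.
  move=> [[u [ule ->]] [V [[FV hV] dV]]].
  pose I := [set i | inner u (x i) == 0]%SET.
  have hu i : if i \in I then inner u (x i) = 0 else inner u (x i) < 0.
    rewrite inE; case: eqP => // /eqP ne.
    by rewrite lt_neqAle ne /=; apply: ule; exact: pos_gen.
  rewrite (subpos_face hu) in FV hV *.
  exists I => //; split; last by apply/facialP; exists u.
  have [h1 h2] := linear_hull_subpos I.
  have := dim_span_gp I gp.
  have -> : <<[seq x i | i <- enum I]>>%VS = V.
    by apply/eqP; rewrite eqEsubv hV // h2.
  (* Since [k < d], the minimum of [#|I|] and [d] can equal [k] only through [#|I|]. *)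
  by rewrite dV; lia.
move=> [I [Ik /facialP[u hu]] <-]; split.
  exists u; split; last by rewrite (subpos_face hu).
  move=> y; apply: pos_inner_le0 => i.
  by have := hu i; case: ifP => _ => [->|/ltW].
exists <<[seq x i | i <- enum I]>>%VS; split; first exact: linear_hull_subpos.
by rewrite dim_span_gp // Ik; lia.
Qed.

(** The functional supporting one face is negative at every generator outside its index set, so such
    a generator cannot lie in that face. *)
Lemma subpos_inj I J : facial I -> facial J -> subpos I = subpos J -> I = J.
Proof.
have sub I' J' : facial J' -> subpos I' = subpos J' -> I' \subset J'.
  move=> /facialP[u hu] e; apply/fintype.subsetP => i iI.
  have := subpos_gen iI; rewrite e -(subpos_face hu) => -[_ h].
  by have := hu i; case: ifP => // _; rewrite h ltxx.
by move=> fI fJ e; apply/eqP; rewrite finset.eqEsubset !sub.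
Qed.

Lemma num_faces_pos k : general_position x -> (k < d)%N -> (d <= n)%N ->
  num_faces k (pos x) =
  (\sum_(I : {set 'I_n} | #|I| == k) (`[<facial I>] : nat))%N%:R%:E.
Proof.
move=> gp kd dn; rewrite /num_faces faces_pos //.
set A := [set I : {set 'I_n} | _].
have fA : finite_set A by exact: finite_finset.
rewrite /counting asboolT; last exact: finite_image.
congr (_%:R%:E).
transitivity (size (finmap.enum_fset (fset_set A))).
  apply/fcard_eq => //; first exact: finite_image.
  apply: inj_card_eq => I J; rewrite !inE => -[_ fI] [_ fJ].
  exact: subpos_inj.
transitivity (size (enum [set I : {set 'I_n} | (#|I| == k) && `[<facial I>]]%SET)).
  apply/perm_size/uniq_perm; rewrite ?enum_uniq ?finmap.fset_uniq //.
  move=> I; rewrite in_fset_set // mem_enum inE.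
  apply/idP/idP; rewrite inE /A /=; first by case=> -> /asboolT ->; rewrite eqxx.
  by case/andP => /eqP -> /asboolP.
rewrite -cardE -sum1_card big_mkcond [RHS]big_mkcond.
by apply: eq_bigr => I _; rewrite inE; case: eqP => // _; case: asboolP.
Qed.

(** Farkas' lemma yields a nonzero functional that is only weakly negative on the generators. It
    vanishes on at most [d] of them, so general position allows it to be made strictly negative. *)
Lemma pos_neqT : general_position x -> (0 < d)%N -> (d <= n)%N ->
  pos x <> setT <-> facial finset.set0.
Proof.
move=> gp d0 dn; split; last first.
  case/facialP => u hu /seteqP[_] h.
  have i : 'I_n by exact: Ordinal (leq_trans d0 dn).
  have ui : inner u (x i) < 0 by have := hu i; rewrite inE.
  have ule j : inner u (x j) <= 0 by have := hu j; rewrite inE => /ltW.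
  have := pos_inner_le0 ule (h (- x i) Logic.I).
  by rewrite innerNr oppr_le0 leNgt ui.
move=> ne; have [y ny] : exists y, ~ pos x y.
  by apply/existsNP => h; apply: ne; apply/seteqP; split.
have [//|[u [ux uy]]] := farkas x y.
have u0 : u != 0 by apply: contraTneq uy => ->; rewrite inner0l ltxx.
pose I := [set i | inner u (x i) == 0]%SET.
have fI : facial I.
  apply/facialP; exists u => i; rewrite inE; case: eqP => // /eqP ne'.
  by rewrite lt_neqAle ne' ux.
have Id : (#|I| <= d)%N.
  rewrite leqNgt; apply/negP => dI; move/eqP: u0; apply.
  apply: (@free_full _ _ _ [seq x i | i <- take d (enum I)]).
  - by apply: gp; rewrite ?take_uniq ?enum_uniq // size_take; case: ifP; lia.
  - by rewrite size_map size_takel // -cardE ltnW.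
  - by move=> z /mapP[i /mem_take + ->]; rewrite mem_enum inE => /eqP.
have dis : [disjoint I & finset.set0]%B.
  by rewrite disjoint_sym finset.disjoints_subset finset.sub0set.
have /(realizable_signs gp Id dis) := fI.
by move=> /(_ finset.set0); rewrite finset.sub0set finset.setU0; apply.
Qed.

End faces_of_positive_hulls.

(** * Measurability of inner products and Gram determinants *)

Section measurability_in_Rd.
Context {R : realType} {d : nat}.

Lemma measurable_bool_set disp (T : measurableType disp) (b : T -> bool) :
  measurable_fun setT b -> measurable [set w | b w].
Proof.
move=> mb; have := mb measurableT [set true] I.
by rewrite setTI; congr (measurable _); apply/seteqP; split => w /=.
Qed.

Lemma continuous_measurable_rV (f : 'rV[R]_d -> R) :
  continuous f -> measurable_fun setT f.
Proof.
move=> /continuousP cf; apply: (measurability _ (RGenOpens.measurableE R)).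
move=> _ [_ [a [b ->]] <-]; rewrite setTI; apply: sub_sigma_algebra.
exact/cf/interval_open.
Qed.

Lemma measurable_coord j : measurable_fun setT (fun x : 'rV[R]_d => x 0 j).
Proof. by apply: continuous_measurable_rV; apply: coord_continuous. Qed.

Lemma measurable_oppv : measurable_fun setT (fun x : 'rV[R]_d => - x).
Proof.
apply: (@measurability _ _ _ _ _ _ (@open 'rV[R]_d)) => //.
move=> _ [U oU <-]; rewrite setTI; apply: sub_sigma_algebra.
have /continuousP : continuous (fun x : 'rV[R]_d => - x).
  move=> /= M s /= /(nbhs_ballP (- M)) [e e0 es].
  apply/nbhs_ballP; exists e => //= N [_ MN]; apply: es.
  split => // i j; have := MN i j.
  by rewrite !mxE /ball /= -opprD normrN.
exact.
Qed.

Context {disp : measure_display} {T : measurableType disp}.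
Implicit Types v : T -> 'rV[R]_d.

Lemma measurable_inner v v' : measurable_fun setT v -> measurable_fun setT v' ->
  measurable_fun setT (fun w => inner (v w) (v' w)).
Proof.
move=> mv mv'; under eq_fun do rewrite innerE.
by apply: measurable_sum => j; apply: measurable_funM;
  apply: (measurableT_comp (measurable_coord j)).
Qed.

(** A polynomial in the coordinates that detects linear independence for any number of vectors,
    which makes independence a measurable condition. *)
Definition gram m (v : 'I_m -> 'rV[R]_d) : R :=
  \det (\matrix_(i, j) inner (v i) (v j)).

Lemma measurable_gram m (v : 'I_m -> T -> 'rV[R]_d) :
  (forall i, measurable_fun setT (v i)) ->
  measurable_fun setT (fun w => gram (fun i => v i w)).
Proof.
move=> mv; rewrite /gram /determinant; apply: measurable_sum => s.
apply: measurable_funM => //; apply: measurable_prod => i _.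
under eq_fun do rewrite mxE; exact: measurable_inner.
Qed.

(** A kernel vector of the Gram matrix gives a combination orthogonal to every [v j], hence to
    itself. *)
Lemma gram_neq0 m (v : 'I_m -> 'rV[R]_d) :
  (gram v != 0) = free [seq v i | i <- enum 'I_m].
Proof.
have tE : [seq v i | i <- enum 'I_m] = [tuple v i | i < m] by [].
have sumE (k : 'I_m -> R) :
    \sum_(i < m) k i *: [tuple v i | i < m]`_i = \sum_i k i *: v i.
  by apply: eq_bigr => i _; rewrite -tnth_nth tnth_mktuple.
rewrite tE; apply/idP/idP => [g0|/freeP fr].
  apply/freeP => k; rewrite sumE => k0 i.
  suff : \row_i k i = 0 by move/rowP => /(_ i); rewrite !mxE.
  apply/eqP; apply: contraNT g0 => r0; apply/det0P; exists (\row_i k i) => //.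
  apply/rowP => j; rewrite !mxE -[RHS](inner0l (v j)) -k0 innerC inner_sumr.
  by apply: eq_bigr => l _; rewrite !mxE innerZr innerC.
apply/det0P => -[k k0 kM]; move/eqP: k0; apply; apply/rowP => i; rewrite mxE.
apply: (fr (fun i => k 0 i)); rewrite sumE.
set y := \sum_i _; suff : inner y y == 0 by rewrite inner_eq0 => /eqP.
apply/eqP; rewrite {2}/y inner_sumr big1 // => j _; rewrite innerZr.
rewrite innerC /y inner_sumr.
have /rowP/(_ j) := kM; rewrite !mxE => kj.
rewrite (_ : \sum_l _ = 0) ?mulr0 // -[RHS]kj.
by apply: eq_bigr => l _; rewrite mxE innerZr innerC.
Qed.

End measurability_in_Rd.

(** * Laws of independent samples *)

Section laws_of_samples.
Context {R : realType} {disp : measure_display} {T : measurableType disp}.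
Context {disp' : measure_display} {U : measurableType disp'}.
Variables (P : probability T R) (phi : probability U R).

Definition sample n (X : 'I_n -> {mfun T >-> U}) (w : T) : n.-tuple U :=
  [tuple X i w | i < n].

Lemma measurable_sample n (X : 'I_n -> {mfun T >-> U}) :
  measurable_fun setT (sample X).
Proof.
apply/measurable_fun_tnthP => i.
rewrite (_ : _ \o _ = X i) //; apply/funext => w /=.
by rewrite tnth_mktuple.
Qed.

Definition boxes n : set (set (n.-tuple U)) :=
  [set A | exists B : 'I_n -> set U, (forall i, measurable (B i)) /\
     A = [set t | forall i, B i (tnth t i)]].

Lemma boxes_generate n : measurable = <<s @boxes n >> :> set (set (n.-tuple U)).
Proof.
apply/seteqP; split; last first.
  apply: smallest_sub; first exact: sigma_algebra_measurable.
  move=> _ [B [mB ->]].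
  rewrite (_ : [set t | _] = \bigcap_(i in [set: 'I_n]) ((@tnth n U)^~ i) @^-1` B i).
    apply: fin_bigcap_measurable => // i _; rewrite -[X in measurable X]setTI.
    exact: measurable_tnth.
  by apply/seteqP; split=> [t h i _|t h i] /=; exact: h.
apply: smallest_sub; first exact: smallest_sigma_algebra.
move=> A; rewrite -bigcup_seq => -[i _ [B mB <-]]; apply: sub_sigma_algebra.
exists (fun j => if j == i then B else setT); split.
  by move=> j; case: ifP.
rewrite setTI; apply/seteqP; split=> [t Bt j|t /(_ i)] /=; last by rewrite eqxx.
by case: eqP => [->|].
Qed.

Lemma boxes_setI n : setI_closed (@boxes n).
Proof.
move=> _ _ [B [mB ->]] [B' [mB' ->]].
exists (fun i => B i `&` B' i); split; first by move=> i; exact: measurableI.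
apply/seteqP; split=> [t [h h'] i|t h] /=; first by split.
by split => i; have [] := h i.
Qed.

Lemma boxes_setT n : @boxes n setT.
Proof. by exists (fun=> setT); split => //; apply/seteqP; split. Qed.

Lemma eq_on_boxes n (m1 m2 : {measure set (n.-tuple U) -> \bar R}) :
  (m1 setT < +oo)%E -> (forall A, @boxes n A -> m1 A = m2 A) ->
  forall A, measurable A -> m1 A = m2 A.
Proof.
move=> m1oo e A mA; apply: (measure_unique (@boxes n) (fun=> setT)) => //.
- exact: boxes_generate.
- exact: boxes_setI.
- by move=> _; exact: boxes_setT.
- by apply/seteqP; split => // t _; exists 0%N.
Qed.

Lemma sample_box n (X : 'I_n -> {mfun T >-> U}) (B : 'I_n -> set U) :
  iid P phi X -> (forall i, measurable (B i)) ->
  P (sample X @^-1` [set t | forall i, B i (tnth t i)]) =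
  (\prod_(i < n) phi (B i))%E.
Proof.
move=> [law ind] mB.
have -> : sample X @^-1` [set t | forall i, B i (tnth t i)] =
    \bigcap_(i in [set` [set: 'I_n]%SET]) X i @^-1` B i.
  apply/seteqP; split=> [w h i _|w h i] /=.
    by have := h i; rewrite tnth_mktuple.
  by rewrite tnth_mktuple; apply: h; rewrite /= inE.
rewrite ind; last by move=> i _.
under eq_bigl do rewrite inE.
by apply: eq_bigr => i _; exact: law.
Qed.

Lemma iid_subfamily m n (f : 'I_m -> 'I_n) (X : 'I_n -> {mfun T >-> U}) :
  injective f -> iid P phi X -> iid P phi (fun i => X (f i)).
Proof.
move=> fI [law ind]; split=> [i A|J A mA]; first exact: law.
(* Transports [A] along [f] without choosing an inverse: off the image of [J] the condition is
   vacuous, on it injectivity leaves a single [j]. *)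
pose B i : set U := [set u | forall j, j \in J -> f j = i -> A j u].
have BE j : j \in J -> B (f j) = A j.
  move=> jJ; apply/seteqP; split=> [u|u Au k kJ] /=; first exact.
  by move=> /fI ->.
have := ind (f @: J)%SET B; rewrite big_imset /=; last by move=> ? ? _ _; exact: fI.
under eq_bigr => i iJ do rewrite BE //.
move=> <-; last by move=> _ /imsetP[j jJ ->]; rewrite BE //; exact: mA.
congr (P _); apply/seteqP; split=> [w h _ /imsetP[j jJ ->]|w h j jJ] /=.
  by rewrite BE //; exact: h.
by rewrite -BE //; apply: h; rewrite /= imset_f.
Qed.

HB.instance Definition _ n (X : 'I_n -> {mfun T >-> U}) :=
  isMeasurableFun.Build _ _ _ _ (sample X) (measurable_sample X).

Definition split_sample n (X : 'I_n.+1 -> {mfun T >-> U}) (w : T) :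
    n.-tuple U * U :=
  (sample (fun i => X (lift ord0 i)) w, X ord0 w).

Lemma measurable_split_sample n (X : 'I_n.+1 -> {mfun T >-> U}) :
  measurable_fun setT (split_sample X).
Proof. exact: measurable_fun_pair. Qed.

HB.instance Definition _ n (X : 'I_n.+1 -> {mfun T >-> U}) :=
  isMeasurableFun.Build _ _ _ _ (split_sample X) (measurable_split_sample X).

(* The joint law of the first vector and the remaining ones is a product measure;
   Fubini then shows that the first one almost surely avoids the span of the rest. *)
Lemma sample_split n (X : 'I_n.+1 -> {mfun T >-> U}) (A : set (n.-tuple U * U)) :
  iid P phi X -> measurable A ->
  distribution P (split_sample X) A =
  (distribution P (sample (fun i => X (lift ord0 i))) \x phi)%E A.
Proof.
move=> hX mA; apply/esym/product_measure_unique => // {mA}A B mA mB.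
set X' : 'I_n -> _ := fun i => X (lift ord0 i).
have hX' : iid P phi X' by apply: iid_subfamily hX; exact: lift_inj.
have mXB : measurable (X ord0 @^-1` B) by exact: measurable_funPTI.
(* For fixed [B] both sides are finite measures in [A], so comparing them on boxes suffices. *)
have [m1 m1E] : exists m : {measure set (n.-tuple U) -> \bar R},
    forall A, m A = P (sample X' @^-1` A `&` X ord0 @^-1` B).
  unshelve eexists (pushforward (mrestr P mXB) (sample X')); last by [].
  exact: measurable_sample.
have phiB : (fine (phi B))%:E = phi B by rewrite fineK // fin_num_measure.
have phiB0 : 0 <= fine (phi B) by rewrite fine_ge0.
pose m2 : {measure set (n.-tuple U) -> \bar R} :=
  mscale (NngNum phiB0) (distribution P (sample X')).
have m2E A' : m2 A' = (P (sample X' @^-1` A') * phi B)%E.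
  by rewrite -phiB muleC.
suff : m1 A = m2 A by rewrite m1E m2E.
apply: eq_on_boxes mA.
  by rewrite m1E preimage_setT setTI (le_lt_trans (probability_le1 P mXB)) ?ltry.
move=> _ [C [mC ->]].
rewrite m1E m2E.
rewrite (sample_box hX' mC).
pose C' i := if unlift ord0 i is Some j then C j else B.
have mC' i : measurable (C' i) by rewrite /C'; case: unlift.
have := sample_box hX mC'; rewrite big_ord_recl {2}/C' unlift_none.
under eq_bigr do rewrite /C' liftK.
rewrite muleC => <-; congr (P _); apply/seteqP; split=> [w [h h0] i|w h] /=.
  rewrite tnth_mktuple /C'; case: unliftP => [j ->|-> //].
  by have := h j; rewrite tnth_mktuple.
split=> [i|]; first by have := h (lift ord0 i); rewrite /C' liftK !tnth_mktuple.
by have := h ord0; rewrite /C' unlift_none tnth_mktuple.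
Qed.

End laws_of_samples.

(** * Sign changes of a sample *)

Section sign_flips.
Context {R : realType} {d : nat}.

Definition flip (b : bool) (x : 'rV[R]_d) : 'rV[R]_d := if b then - x else x.

Lemma measurable_flip b : measurable_fun setT (flip b).
Proof. by case: b; [exact: measurable_oppv|exact: measurable_id]. Qed.

HB.instance Definition _ b :=
  isMeasurableFun.Build _ _ _ _ (flip b) (measurable_flip b).

Context {disp : measure_display} {T : measurableType disp}.
Variables (P : probability T R) (phi : probability 'rV[R]_d R).

(** The default [false] leaves vectors beyond the length of [s] unchanged. *)
Definition flip_sample n (X : 'I_n -> {mfun T >-> 'rV[R]_d}) (s : bitseq) :
    'I_n -> {mfun T >-> 'rV[R]_d} := fun i => flip (nth false s i) \o X i.

Lemma iid_flip n (X : 'I_n -> {mfun T >-> 'rV[R]_d}) s :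
  even_measure phi -> iid P phi X -> iid P phi (flip_sample X s).
Proof.
move=> ev [law ind]; split=> [i A mA|J A mA].
  have mfA : measurable (flip (nth false s i) @^-1` A) by exact: measurable_funPTI.
  transitivity (phi (flip (nth false s i) @^-1` A)); first exact: (law i).
  case: (nth false s i) => //; rewrite [RHS]ev //; congr (phi _).
  apply/seteqP; split=> [x Ax|_ [x Ax <-]] /=; last by rewrite opprK.
  by exists (- x); rewrite ?opprK.
have /= <- := ind J (fun i => flip (nth false s i) @^-1` A i) => [//|i iJ].
by apply: measurable_funPTI; exact: mA.
Qed.

(** A functional is negative at a flipped vector exactly when it is positive at the original one,
    while equations on [I] do not see the flip. *)
Lemma facial_flip n (x : 'I_n -> 'rV[R]_d) s I : size s = n ->
  facial (fun i => flip (nth false s i) (x i)) I <->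
  realizable x (pattern [::] [seq (i, i \in I) | i <- enum 'I_n] s).
Proof.
move=> ss; have -> : pattern [::] [seq (i, i \in I) | i <- enum 'I_n] s =
    [seq (i, if i \in I then None else Some (nth false s i)) | i <- enum 'I_n].
  have {1}-> : s = [seq nth false s (val i) | i <- enum 'I_n].
    by rewrite map_comp val_enum_ord -ss; exact/esym/mkseq_nth.
  by rewrite /pattern /= zip_map -map_comp.
have satE u i : satisfies u (x i) (if i \in I then None else Some (nth false s i)) =
    satisfies u (flip (nth false s i) (x i))
      (if i \in I then None else Some (i \in finset.set0)).
  rewrite inE /satisfies /flip; case: ifP => _; case: nth => //=.
    by rewrite innerNr oppr_eq0.
  by rewrite innerNr oppr_lt0.
split=> -[u hu]; exists u => _ /mapP[i iI ->] /=.
  rewrite satE.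
  by apply: (hu (i, if i \in I then None else Some (i \in finset.set0))); exact: map_f.
by rewrite -satE; apply: (hu (i, if i \in I then None else Some (nth false s i))); exact: map_f.
Qed.

Lemma count_facial_flip n (x : 'I_n -> 'rV[R]_d) (I : {set 'I_n}) :
  general_position x -> (#|I| <= d)%N ->
  (\sum_(s <- bitseqs n) `[<facial (fun i => flip (nth false s i) (x i)) I>] =
   2 ^ #|I| * schlaefli (n - #|I|) (d - #|I|))%N.
Proof.
move=> gp Id; pose xs := [seq (i, i \in I) | i <- enum 'I_n].
have xsn : size xs = n by rewrite size_map size_enum_ord.
have xsI : count snd xs = #|I|.
  by rewrite count_map -sum1_count -sum1_card big_enum_cond.
have := @count_realizable _ _ _ x [::] xs gp; rewrite xsn xsI => /= <- //.
  rewrite big_seq [RHS]big_seq; apply: eq_bigr => s /bitseqs_size ss.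
  by congr (nat_of_bool _); apply: asbool_equiv_eq; exact: facial_flip.
by rewrite -map_comp map_id enum_uniq.
Qed.

End sign_flips.

(** * Measurability of the face and cone events *)

Section events.
Context {R : realType} {d n : nat}.
Implicit Types (x : 'I_n -> 'rV[R]_d) (K I : {set 'I_n}).

(* An open sign pattern is realized by a rational functional as soon as it is
   realized at all: coordinates are made rational one at a time. *)
Lemma realizable_rat x K :
  realizable x (signs finset.set0 K) <->
  exists u : 'rV[rat]_d, forall i,
    satisfies (map_mx ratr u) (x i) (Some (i \in K)).
Proof.
split=> [[u hu]|[u hu]]; last first.
  by exists (map_mx ratr u) => _ /mapP[i _ ->] /=; rewrite inE; exact: hu.
suff [v hv [q qv]] : exists2 v : 'rV[R]_d,
    (forall p, p \in signs finset.set0 K -> satisfies v (x p.1) p.2) &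
    exists q : 'rV[rat]_d, forall j, j \in enum 'I_d -> v 0 j = ratr (q 0 j).
  exists q => i; have -> : map_mx ratr q = v.
    by apply/rowP => j; rewrite mxE qv // mem_enum.
  have /hv : (i, if i \in finset.set0 then None else Some (i \in K)) \in
      signs finset.set0 K by apply: map_f; rewrite mem_enum.
  by rewrite inE.
elim: (enum 'I_d) => [|j r [v hv [q qv]]]; first by exists u => //; exists 0.
have z0 : zeros (signs (n := n) finset.set0 K) = [::].
  apply/eqP; rewrite -size_eq0 size_map size_filter -leqn0 leqNgt -has_count.
  by apply/hasPn => _ /mapP[i _ ->]; rewrite inE.
have [|t t0 ht] := @perturb _ _ _ x v (delta_mx 0 j) _ hv.
  by rewrite z0.
have /rat_in_itvoo[a] : v 0 j < v 0 j + t by rewrite ltrDl.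
rewrite in_itv /= => /andP[va av].
exists (v + (ratr a - v 0 j) *: delta_mx 0 j).
  by apply: ht; rewrite ler_norml; apply/andP; split; lra.
exists (\row_l if l == j then a else q 0 l) => l; rewrite inE !mxE.
rewrite eqxx /=; have [->|lj] := eqVneq l j; first by rewrite mulr1 addrC subrK.
by rewrite mulr0 addr0 => /qv.
Qed.

Lemma measurable_realizable K :
  measurable [set t : n.-tuple 'rV[R]_d | realizable (tnth t) (signs finset.set0 K)].
Proof.
rewrite (_ : [set t | _] = \bigcup_(u : 'rV[rat]_d) \bigcap_(i in [set: 'I_n])
    [set t : n.-tuple 'rV[R]_d | satisfies (map_mx ratr u) (tnth t i) (Some (i \in K))]).
  apply: countable_bigcupT_measurable => [|u]; first exact: countableP.
  apply: fin_bigcap_measurable => // i _; apply: measurable_bool_set.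
  have mi : measurable_fun setT
      (fun t : n.-tuple 'rV[R]_d => inner (map_mx ratr u) (tnth t i)).
    by apply: measurable_inner => //; exact: measurable_tnth.
  by case: (i \in K); apply: measurable_fun_ltr.
apply/seteqP; split=> [t /realizable_rat[u hu]|t [u _ hu]] /=.
  by exists u => // i _; exact: hu.
by apply/realizable_rat; exists u => i; exact: hu.
Qed.

(* Coincides almost surely with the event that I spans a face. *)
Definition facial_event I : set (n.-tuple 'rV[R]_d) :=
  [set t | forall K : {set 'I_n}, K \subset I ->
    realizable (tnth t) (signs finset.set0 K)].

Lemma measurable_facial_event I : measurable (facial_event I).
Proof.
rewrite (_ : facial_event I = \bigcap_(K in [set K : {set 'I_n} | K \subset I])
    [set t | realizable (tnth t) (signs finset.set0 K)]).
  by apply: fin_bigcap_measurable => [|K _]; [exact: finite_finset|exact: measurable_realizable].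
by apply/seteqP; split=> t h K; exact: h.
Qed.

Lemma facial_eventP (t : n.-tuple 'rV[R]_d) I :
  general_position (tnth t) -> (#|I| <= d)%N ->
  facial_event I t <-> facial (tnth t) I.
Proof.
move=> gp Id; rewrite /facial realizable_signs //; last first.
  by rewrite disjoint_sym finset.disjoints_subset finset.sub0set.
by split=> h K KI; have := h K KI; rewrite finset.set0U.
Qed.

Definition signed_unit b (j : 'I_d) : 'rV[R]_d := (-1) ^+ nat_of_bool b *: delta_mx 0 j.

(* By Farkas' lemma it is enough to approximate the vectors +-e_j up to 1/2 in the
   l1-norm; this exhibits the event that the positive hull is everything as a
   countable combination of open conditions, including the degenerate samples. *)
Lemma pos_eqT x :
  pos x = setT <-> forall b j, exists q : {ffun 'I_n -> rat},
    (forall i, 0 <= q i) /\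
    \sum_l `|\sum_i ratr (q i) * x i 0 l - signed_unit b j 0 l| < 1 / 2.
Proof.
split=> [pT b j|h].
  have [c [c0 cE]] : pos x (signed_unit b j) by rewrite pT.
  (* The summand 1 keeps [S] positive. Rounding each coefficient up by at most [e] keeps it
     nonnegative and costs less than [e * S], which is 1/2, in the l1-norm. *)
  pose S := 1 + \sum_l \sum_i `|x i 0 l|.
  have S0 : 0 < S by rewrite ltr_pwDl // sumr_ge0 // => l _; rewrite sumr_ge0.
  pose e := (1 / 2) / S; have e0 : 0 < e by rewrite divr_gt0.
  have /fin_all_exists[q hq] (i : 'I_n) : exists q : rat, c i <= ratr q <= c i + e.
    have /rat_in_itvoo[q] : c i < c i + e by rewrite ltrDl.
    by rewrite in_itv /= => /andP[/ltW h1 /ltW h2]; exists q; rewrite h1.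
  exists [ffun i => q i]; split=> [i|].
    rewrite ffunE -(@ler0q R); have /andP[+ _] := hq i.
    exact: le_trans.
  apply: (@le_lt_trans _ _ (e * \sum_l \sum_i `|x i 0 l|)).
    rewrite mulr_sumr; apply: ler_sum => l _.
    rewrite cE summxE -sumrB mulr_sumr; apply: (le_trans (ler_norm_sum _ _ _)).
    apply: ler_sum => i _; rewrite ffunE mxE -mulrBl normrM ler_wpM2r //.
    have /andP[h1 h2] := hq i; rewrite ger0_norm ?subr_ge0 //; lra.
  apply: (@lt_le_trans _ _ (e * S)); first by rewrite ltr_pM2l // ltrDr.
  by rewrite divfK // gt_eqF.
apply/seteqP; split=> // y _; have [//|[u [ux uy]]] := farkas x y.
have [j0 uj0] : exists j, u 0 j != 0.
  apply/existsP; rewrite -negb_forall; apply: contraTN uy => /forallP u0.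
  by rewrite (_ : u = 0) ?inner0l ?ltxx //; apply/rowP => j; rewrite mxE; exact/eqP.
(* At a coordinate of largest modulus, an l1-error below 1/2 changes the value of [u] by at most
   half of that modulus, so [u] would be positive at the approximant [z], which lies in the cone. *)
pose j := [arg max_(j > j0) `|u 0 j|]%O.
have jmax l : `|u 0 l| <= `|u 0 j|.
  by rewrite /j; case: Order.TotalTheory.arg_maxP => // i _; exact.
have uj : 0 < `|u 0 j| by rewrite (lt_le_trans _ (jmax j0)) // normr_gt0.
have [q [q0 hq]] := h (u 0 j < 0) j.
set e := signed_unit (u 0 j < 0) j.
pose z := \sum_i ratr (q i) *: x i.
have uz : inner u z <= 0.
  apply: (pos_inner_le0 ux); exists (fun i => ratr (q i)); split => // i.
  by rewrite ler0q.
have ue : inner u e = `|u 0 j|.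
  rewrite innerZr innerE (bigD1 j) //= big1 => [|l lj]; last first.
    by rewrite mxE (negbTE lj) andbF mulr0.
  rewrite mxE !eqxx mulr1 addr0; have [u0|u0] := ltP (u 0 j) 0.
    by rewrite expr1 mulN1r ltr0_norm.
  by rewrite expr0 mul1r ger0_norm.
have : inner u e - inner u z <= `|u 0 j| * (1 / 2).
  apply: (@le_trans _ _ (`|u 0 j| * \sum_l `|z 0 l - e 0 l|)); last first.
    rewrite ler_pM2l //; apply: ltW; move: hq; congr (_ < _).
    apply: eq_bigr => l _; rewrite summxE; congr `|_ - _|.
    by apply: eq_bigr => i _; rewrite mxE.
  rewrite !innerE -sumrB mulr_sumr; apply: ler_sum => l _.
  rewrite -mulrBr distrC (le_trans (ler_norm _)) // normrM.
  by rewrite ler_wpM2r.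
rewrite ue; lra.
Qed.

Lemma measurable_pos_neqT :
  measurable [set t : n.-tuple 'rV[R]_d | pos (tnth t) <> setT].
Proof.
rewrite (_ : [set t | _] = ~` [set t : n.-tuple 'rV[R]_d | pos (tnth t) = setT]) //.
apply: measurableC.
pose near_unit (t : n.-tuple 'rV[R]_d) b (j : 'I_d) (q : {ffun 'I_n -> rat}) :=
  \sum_l `|\sum_i ratr (q i) * tnth t i 0 l - signed_unit b j 0 l| < 1 / 2.
rewrite (_ : [set t | _] =
  \bigcap_(b in [set: bool]) \bigcap_(j in [set: 'I_d])
  \bigcup_(q : {ffun 'I_n -> rat})
    [set t | [forall i, 0 <= q i] && near_unit t b j q]).
  apply: fin_bigcap_measurable => // b _; apply: fin_bigcap_measurable => // j _.
  apply: countable_bigcupT_measurable => [|q]; first exact: countableP.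
  case: [forall i, 0 <= q i] => /=; last first.
    by rewrite (_ : [set _ | _] = set0) //; apply/seteqP; split.
  apply: measurable_bool_set; apply: measurable_fun_ltr => //.
  apply: measurable_sum => l; apply: measurableT_comp => //.
  apply: measurable_funB => //; apply: measurable_sum => i.
  apply: measurable_funM => //; apply: (measurableT_comp (measurable_coord l)).
  exact: measurable_tnth.
apply/seteqP; split=> [t /pos_eqT h b _ j _|t h] /=.
  by have [q [/forallP q0 hq]] := h b j; exists q => //=; rewrite q0.
by apply/pos_eqT => b j; have [q _ /andP[/forallP q0 hq]] := h b I j I; exists q.
Qed.

End events.

(** * Almost sure general position *)

Section general_position_ae.
Context {R : realType} {d : nat}.
Variable phi : probability 'rV[R]_d R.
Hypothesis phi_null : null_on_hyperplanes phi.
Context {disp : measure_display} {T : measurableType disp}.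
Variable P : probability T R.

(** Fewer than [d] vectors miss some [y]; the dual vector of [y] relative to a basis of their span
    is normal to a hyperplane through the origin containing the span. *)
Lemma span_null (X : seq 'rV[R]_d) (B : set 'rV[R]_d) : (size X < d)%N ->
  measurable B -> B `<=` [set x | x \in <<X>>%VS] -> phi B = 0%E.
Proof.
move=> sX mB BX.
have [y ny] : exists y, y \notin <<X>>%VS.
  apply: contrapT => /forallNP allX; move: sX; rewrite ltnNge => /negP; apply.
  have /dimvS : (fullv <= <<X>>)%VS by apply/subvP => y _; apply/negPn/negP/(allX y).
  by rewrite dimvf /dim /= mul1n => /leq_trans; apply; exact: dim_span.
have spanE := span_basis (vbasisP <<X>>).
have [|u [uy uX]] := @free_cons_dual _ _ y (vbasis <<X>>).
  by rewrite free_cons spanE ny (basis_free (vbasisP _)).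
have u0 : u != 0.
  by apply: contra_eq_neq uy => ->; rewrite inner0l eq_sym oner_eq0.
have hE : [set x | inner u x = 0] = [set x | inner u x == 0].
  by apply/seteqP; split=> x /=; [move=> ->|move/eqP].
apply: (subset_measure0 mB _ _ (phi_null u0)).
  rewrite hE; apply: measurable_bool_set; apply: measurable_fun_eqr => //.
  exact: measurable_inner.
by move=> x /BX /= xX; apply: inner_span_eq0 uX _; rewrite spanE.
Qed.

Lemma sample_free m (X : 'I_m -> {mfun T >-> 'rV[R]_d}) :
  (m <= d)%N -> iid P phi X ->
  \forall w \ae P, free [seq X i w | i <- enum 'I_m].
Proof.
elim: m X => [|m ih] X md hX.
  by apply: aeW => w; rewrite (size0nil (size_enum_ord 0)) nil_free.
pose X' : 'I_m -> {mfun T >-> 'rV[R]_d} := fun i => X (lift ord0 i).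
have hX' : iid P phi X' by apply: iid_subfamily hX; exact: lift_inj.
pose cons_tuple (p : m.-tuple 'rV[R]_d * 'rV[R]_d) (i : 'I_m.+1) :=
  if unlift ord0 i is Some j then tnth p.1 j else p.2.
have consE p : [seq cons_tuple p i | i <- enum 'I_m.+1] =
    p.2 :: [seq tnth p.1 i | i <- enum 'I_m].
  rewrite enum_ordSl /= {1}/cons_tuple unlift_none -map_comp; congr cons.
  by apply: eq_map => i; rewrite /= /cons_tuple liftK.
(* The event that the later vectors are independent but adding the first one destroys
   independence. *)
pose B := [set p : m.-tuple 'rV[R]_d * 'rV[R]_d |
  (gram (tnth p.1) != 0) && (gram (cons_tuple p) == 0)].
have mB : measurable B.
  apply: measurable_bool_set; apply: measurable_and.
    apply: measurable_neg; apply: measurable_fun_eqr => //.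
    apply: (measurable_gram (v := fun i p => tnth p.1 i)) => i.
    apply: (measurableT_comp (measurable_tnth i)); exact: measurable_fst.
  apply: measurable_fun_eqr => //.
  apply: (measurable_gram (v := fun i p => cons_tuple p i)) => i.
  rewrite /cons_tuple; case: unliftP => [j _|_]; last exact: measurable_snd.
  apply: (measurableT_comp (measurable_tnth j)); exact: measurable_fst.
have B0 : P (split_sample X @^-1` B) = 0%E.
  transitivity ((distribution P (sample X') \x phi)%E B).
    exact: (sample_split hX mB).
  rewrite /product_measure1; apply: integral0_eq => t _ /=.
  have mBt : measurable (xsection B t) by exact: measurable_xsection.
  (* The section is empty for dependent [t] and otherwise lies in the span of [t]. *)
  have [g0|g0] := eqVneq (gram (tnth t)) 0.
    rewrite (_ : xsection B t = set0) ?measure0 //.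
    apply/seteqP; split=> // x; rewrite /xsection /= inE /B /=.
    by rewrite g0 eqxx.
  apply: (@span_null [seq tnth t i | i <- enum 'I_m]) => //.
    by rewrite size_map size_enum_ord.
  move=> x; rewrite /xsection /= inE /B /= => /andP[_ g].
  have := gram_neq0 (cons_tuple (t, x)).
  rewrite g /= consE free_cons /= -gram_neq0 g0 andbT => /esym.
  by move=> /negbFE.
have mB' : measurable (split_sample X @^-1` B) by exact: measurable_funPTI.
have : \forall w \ae P, ~ B (split_sample X w).
  by exists (split_sample X @^-1` B); split => // w /= /contrapT.
apply: filterS2 (ih X' (ltnW md) hX') => w fr nB.
have sE i : tnth (split_sample X w).1 i = X' i w by rewrite tnth_mktuple.
have -> : [seq X i w | i <- enum 'I_m.+1] =
    [seq cons_tuple (split_sample X w) i | i <- enum 'I_m.+1].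
  rewrite consE enum_ordSl /= -map_comp; congr cons.
  by apply: eq_map => i; rewrite /= tnth_mktuple.
rewrite -gram_neq0; apply: contra_notN nB => g; rewrite /B /= g andbT.
rewrite gram_neq0; move: fr; congr (is_true (free _)).
by apply: eq_map => i; rewrite sE.
Qed.

Lemma sample_general_position n (X : 'I_n -> {mfun T >-> 'rV[R]_d}) :
  iid P phi X -> \forall w \ae P, general_position (tnth (sample X w)).
Proof.
move=> hX.
(* Bounded lengths and tuples make the index lists a finite family, so the exceptional null sets can
   be united. *)
have h (m : 'I_d.+1) (t : m.-tuple 'I_n) :
    \forall w \ae P, uniq t -> free [seq X i w | i <- t].
  have [ut|nut] := boolP (uniq t); last by exact: aeW.
  have ti : injective (tnth t) by apply/tuple_uniqP.
  have := @sample_free m (fun i => X (tnth t i)) (ltn_ord m) (iid_subfamily ti hX).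
  apply: filterS => w + _; congr (is_true (free _)).
  by rewrite -[in RHS](map_tnth_enum t) -map_comp.
have h' (m : 'I_d.+1) : \forall w \ae P, forall t : m.-tuple 'I_n,
    uniq t -> free [seq X i w | i <- t].
  by apply: filter_forall => t; exact: h.
have := @filter_forall T _ _ _ (ae_filter_ringOfSetsType P) h'.
apply: filterS => w hw s us sd.
have -> : [seq tnth (sample X w) i | i <- s] = [seq X i w | i <- s].
  by apply: eq_map => i; rewrite tnth_mktuple.
exact: (hw (Ordinal (sd : (size s < d.+1)%N)) (in_tuple s) us).
Qed.

End general_position_ae.

(** * Integrals of nonmeasurable functions *)

Section nonmeasurable_integrands.
Context {R : realType} {disp : measure_display} {T : measurableType disp}.
Variable mu : {measure set T -> \bar R}.
Implicit Types f g : T -> \bar R.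

Lemma le_integral_nonmeasurable f g : (forall x, 0 <= f x)%E ->
  (forall x, f x <= g x)%E -> (\int[mu]_x f x <= \int[mu]_x g x)%E.
Proof.
move=> f0 fg; have g0 x : (0 <= g x)%E by exact: le_trans (fg x).
rewrite !ge0_integralTE //; apply: le_ereal_sup => _ [h hf <-].
by exists h => // x; exact: le_trans (fg x).
Qed.

(* The integral of a nonmeasurable function is a lower integral, so squeezing
   f between two modifications of g on a null set suffices. *)
Lemma ae_eq_integral_nonmeasurable f g : measurable_fun setT g ->
  (forall x, 0 <= f x)%E -> (forall x, 0 <= g x)%E ->
  (\forall x \ae mu, f x = g x) -> (\int[mu]_x f x = \int[mu]_x g x)%E.
Proof.
move=> mg f0 g0 [N [mN N0 fgN]].
have fgE x : ~ N x -> f x = g x by move=> nx; apply: contrapT => /fgN.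
pose h (c : \bar R) x := if x \in N then c else g x.
have hint c : (\int[mu]_x h c x = \int[mu]_x g x)%E.
  apply: ae_eq_integral => //.
    apply: measurable_fun_ifT => //; apply: (measurable_fun_bool true).
    rewrite setTI (_ : _ @^-1` _ = N) //.
    by apply/seteqP; split=> x /=; [move/set_mem|move/mem_set].
  exists N; split=> // x /= /not_implyP[_]; rewrite /h.
  by case: ifPn; rewrite ?inE.
apply/eqP; rewrite eq_le -{1}(hint +oo%E) -(hint 0%E).
apply/andP; split; apply: le_integral_nonmeasurable => // x; rewrite /h;
  case: ifPn; rewrite ?notin_setE ?leey // => /fgE -> //.
Qed.

Lemma measure_ae_eq (A B : set T) : measurable A -> measurable B ->
  (\forall x \ae mu, A x <-> B x) -> mu A = mu B.
Proof.
move=> mA mB AB; rewrite -[A]setIT -[B]setIT -!integral_indic //.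
apply: ae_eq_integral => //.
- exact/measurable_EFinP/measurable_indic.
- exact/measurable_EFinP/measurable_indic.
- apply: filterS AB => x ABx _; rewrite !indicE; congr (_%:R%:E).
  by congr nat_of_bool; apply/idP/idP; rewrite !inE => /ABx.
Qed.

End nonmeasurable_integrands.

(** * Expected face numbers and the inequality *)

Section cover_efron.
Context {R : realType} {d : nat}.
Variable phi : probability 'rV[R]_d R.
Hypotheses (phi_even : even_measure phi) (phi_null : null_on_hyperplanes phi).

Lemma sample_law_unique disp1 (T1 : measurableType disp1) (P1 : probability T1 R)
    disp2 (T2 : measurableType disp2) (P2 : probability T2 R) n
    (X : 'I_n -> {mfun T1 >-> 'rV[R]_d}) (Y : 'I_n -> {mfun T2 >-> 'rV[R]_d}) A :
  iid P1 phi X -> iid P2 phi Y -> measurable A ->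
  P1 (sample X @^-1` A) = P2 (sample Y @^-1` A).
Proof.
move=> hX hY mA.
apply: (eq_on_boxes (m1 := distribution P1 (sample X))
  (m2 := distribution P2 (sample Y))) mA.
  exact: (le_lt_trans (probability_le1 (distribution P1 (sample X)) measurableT) (ltry _)).
move=> _ [B [mB ->]].
exact: etrans (sample_box hX mB) (esym (sample_box hY mB)).
Qed.

Context {disp : measure_display} {T : measurableType disp}.
Variables (P : probability T R) (n : nat) (X : 'I_n -> {mfun T >-> 'rV[R]_d}).
Hypothesis X_iid : iid P phi X.

(** Integrate the number of sign changes that make [I] facial: almost surely it is the constant [c],
    and each of the [2 ^ n] sign changes contributes the same probability. *)
Lemma prob_facial (I : {set 'I_n}) : (#|I| <= d)%N ->
  P (sample X @^-1` facial_event I) =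
  ((2 ^ #|I| * schlaefli (n - #|I|) (d - #|I|))%:R / 2 ^+ n)%:E.
Proof.
move=> Id; set c := (2 ^ #|I| * _)%N.
pose A s := sample (flip_sample X s) @^-1` facial_event I.
have mA s : measurable (A s).
  by apply: measurable_funPTI; exact: measurable_facial_event.
have PA s : P (A s) = P (sample X @^-1` facial_event I).
  apply: sample_law_unique => //; [exact: iid_flip|exact: measurable_facial_event].
have gpA : \forall w \ae P, forall s : n.-tuple bool,
    general_position (tnth (sample (flip_sample X s) w)).
  apply: (@filter_forall T _ _ _ (ae_filter_ringOfSetsType P)) => s.
  by apply: (sample_general_position phi_null); exact: iid_flip.
have mI s : measurable_fun setT (fun w => (\1_(A s) w)%:E : \bar R).
  exact/measurable_EFinP/measurable_indic.
have : (\int[P]_w \sum_(s <- bitseqs n) (\1_(A s) w)%:E = c%:R%:E)%E.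
  transitivity (\int[P]_w (cst c%:R%:E w))%E; last first.
    by rewrite -[RHS]mule1 -(probability_setT P); exact: integral_cst.
  apply: ae_eq_integral => //; first exact: emeasurable_sum.
  apply: filterS2 gpA (sample_general_position phi_null X_iid) => w gp gpX _ /=.
  rewrite sumEFin; congr (_%:E); rewrite /c -(count_facial_flip gpX Id) natr_sum.
  rewrite big_seq [RHS]big_seq; apply: eq_bigr => s /bitseqs_size ss.
  rewrite indicE; congr (_%:R); congr nat_of_bool.
  have tE : tnth (sample (flip_sample X s) w) =
      fun i => flip (nth false s i) (tnth (sample X w) i).
    by apply/funext => i; rewrite !tnth_mktuple.
  have gps := gp (tcast ss (in_tuple s)); rewrite val_tcast /= in gps.
  have e := facial_eventP gps Id; rewrite tE in e.
  by apply/idP/asboolP; rewrite inE => /e.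
rewrite ge0_integral_sum //.
set p := P _; rewrite (eq_bigr (fun=> p)); last first.
  by move=> s _; rewrite integral_indic // setIT; exact: PA.
have -> : p = (fine p)%:E.
  rewrite fineK // /p; apply: fin_num_measure.
  by apply: measurable_funPTI; exact: measurable_facial_event.
rewrite sumEFin big_const_seq count_predT size_bitseqs iter_addr_0 => -[<-].
by rewrite -[_ *+ (2 ^ n)%N]mulr_natr natrX mulfK // expf_neq0.
Qed.

Lemma mean_faces k : (k < d)%N -> (d <= n)%N ->
  cover_efron_mean_faces P X k =
  ('C(n, k)%:R * (2 ^ k * schlaefli (n - k) (d - k))%:R / (schlaefli n d)%:R)%:E.
Proof.
move=> kd dn; have d0 : (0 < d)%N by exact: leq_ltn_trans kd.
have XE w : (fun i => X i w) = tnth (sample X w).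
  by apply/funext => i; rewrite tnth_mktuple.
rewrite /cover_efron_mean_faces; set E := [set w | _].
have EE : E = sample X @^-1` [set t | pos (tnth t) <> setT].
  by apply/seteqP; split => w /=; rewrite /E /= XE.
have mE : measurable E.
  by rewrite EE; apply: measurable_funPTI; exact: measurable_pos_neqT.
pose F I := sample X @^-1` facial_event I.
have mF I : measurable (F I).
  by apply: measurable_funPTI; exact: measurable_facial_event.
have gp := sample_general_position phi_null X_iid.
have Egp w : general_position (tnth (sample X w)) -> E w <-> F finset.set0 w.
  move=> gpw; rewrite EE /=; apply: (iff_trans (pos_neqT gpw d0 dn)).
  by apply: iff_sym; apply: facial_eventP; rewrite // cards0.
have PE : P E = ((schlaefli n d)%:R / 2 ^+ n)%:E.
  transitivity (P (F finset.set0)).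
    by apply: measure_ae_eq => //; exact: filterS gp.
  by rewrite /F prob_facial cards0 // expn0 mul1n !subn0.
(* The subset [K] empty in [facial_event] already gives a functional negative on all generators, so
   a face event almost surely entails properness. *)
have PFE I : P (F I `&` E) = P (F I).
  apply: measure_ae_eq => //; first exact: measurableI.
  apply: filterS gp => w gpw; split=> [[]//|FI]; split=> //.
  apply/(Egp w gpw) => K; rewrite finset.subset0 => /eqP ->.
  exact/FI/finset.sub0set.
have s0 : (0 : R) < (schlaefli n d)%:R.
  by rewrite ltr0n -(prednK d0) schlaefli_gt0.
have p0 : 0 < (schlaefli n d)%:R / 2 ^+ n :> R by rewrite divr_gt0 // exprn_gt0.
set p := _ / _ in PE p0.
have pV0 : 0 <= p^-1 by rewrite invr_ge0 ltW.
pose mu : {measure set T -> \bar R} := mscale (NngNum pV0) (mrestr P mE).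
have muE A : mu A = (p^-1%:E * P (A `&` E))%E by [].
have -> : cond_probability P E = mu.
  by apply/funext => A; rewrite /cond_probability PE inver gt_eqF // muleC.
pose S := enum [set I : {set 'I_n} | #|I| == k]%SET.
(* Linearity of the integral needs measurable summands; the face count agrees with this sum of
   indicators only in general position. *)
transitivity (\int[mu]_w \sum_(I <- S) (\1_(F I) w)%:E)%E.
  have mI I : measurable_fun setT (fun w => (\1_(F I) w)%:E : \bar R).
    exact/measurable_EFinP/measurable_indic.
  apply: ae_eq_integral_nonmeasurable => //.
  - exact: emeasurable_sum.
  - by move=> w; rewrite /num_faces /counting; case: ifP; rewrite ?leey ?lee_fin.
  - by move=> w; apply: sume_ge0 => I _; rewrite lee_fin.
  have [N [mN N0 hN]] := gp; exists N; split => //.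
    rewrite muE (subset_measure0 (B := N)) ?mule0 //; exact: measurableI.
  move=> w; apply: contra_notP => nNw.
  have {nNw}gpw : general_position (tnth (sample X w)).
    by apply: contrapT => /hN.
  rewrite /= XE num_faces_pos // sumEFin natr_sum; congr (_%:E).
  rewrite /S big_enum; apply: eq_big => [I|I /eqP Ik]; first by rewrite inE.
  rewrite indicE; congr (_%:R); congr nat_of_bool.
  have e : F I w <-> _ := facial_eventP gpw _.
  by apply/asboolP/idP; rewrite inE => /e; apply; rewrite Ik ltnW.
rewrite ge0_integral_sum //; last by move=> I; exact/measurable_EFinP/measurable_indic.
under eq_bigr do rewrite integral_indic // setIT muE PFE.
pose q : R := (2 ^ k * schlaefli (n - k) (d - k))%:R / 2 ^+ n.
rewrite (eq_big_seq (fun=> (p^-1 * q)%:E)); last first.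
  move=> I; rewrite mem_enum inE => /eqP Ik.
  by rewrite prob_facial Ik ?(ltnW kd) // -EFinM.
rewrite sumEFin big_const_seq count_predT iter_addr_0 -cardE card_draws card_ord.
congr (_%:E); rewrite -[LHS]mulr_natl -[RHS]mulrA; congr (_ * _).
by rewrite /p /q invfM invrK mulrC mulrACA mulVf ?mulr1 ?mul1r // expf_neq0.
Qed.

End cover_efron.

Theorem theorem1 (R : realType) (d N k : nat)
  (k_ge1 : (1 <= k)%N) (k_lt_d : (k < d)%N) (d_lt_N : (d < N)%N)
  (phi : probability 'rV[R]_d R)
  (phi_even : even_measure phi) (phi_null : null_on_hyperplanes phi)
  (disp1 : measure_display) (T1 : measurableType disp1) (P1 : probability T1 R)
  (X : 'I_N -> {mfun T1 >-> 'rV[R]_d}) (X_iid : iid P1 phi X)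
  (disp2 : measure_display) (T2 : measurableType disp2) (P2 : probability T2 R)
  (Y : 'I_N.+1 -> {mfun T2 >-> 'rV[R]_d}) (Y_iid : iid P2 phi Y) :
  (cover_efron_mean_faces P2 Y k / ('C(N.+1, k)%:R : R)%:E
   < cover_efron_mean_faces P1 X k / ('C(N, k)%:R : R)%:E)%E.
Proof.
have dN := ltnW d_lt_N; have kN := ltn_trans k_lt_d d_lt_N.
rewrite (mean_faces phi_even phi_null X_iid k_lt_d dN).
rewrite (mean_faces phi_even phi_null Y_iid k_lt_d (leqW dN)).
have C0 m : (k <= m)%N -> ('C(m, k)%:R : R) != 0.
  by move=> km; rewrite pnatr_eq0 -lt0n bin_gt0.
have D0 m : (0 : R) < (schlaefli m d)%:R.
  by rewrite ltr0n -(prednK (leq_ltn_trans (leq0n k) k_lt_d)) schlaefli_gt0.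
have kN' := ltnW kN; have kN1 := leqW kN'.
rewrite !inver !ifN ?C0 // -!EFinM lte_fin.
have cancelC (c a b : R) : c != 0 -> c * a / b / c = a / b.
  by move=> c0; rewrite mulrAC [c * a]mulrC mulfK.
rewrite !cancelC ?C0 // ltr_pdivrMr // mulrAC ltr_pdivlMr //.
(* The denominators are cleared; cancelling [2 ^ k] leaves an inequality between natural numbers. *)
rewrite -!natrM ltr_nat -!mulnA ltn_pmul2l ?expn_gt0 //.
exact: schlaefli_lt.
Qed.
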